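(* Let $a>1$ and $(x,u,\eta)\in\mathbb{R}^3$. For $m,k\ge0$, let $S_n^{h_m,x}(t,a)=h_m(t-x)F_n(t,a)$. Then $$\lim_{n\to\infty}V_{h_k}(S_n^{h_m,x})(u,\eta)=\sqrt\pi\,(-1)^m2^{\frac{k+m}{2}}e^{-\frac{(a-\eta)^2}{4}+\frac{i(x+u)(a-\eta)}{2}-\frac{(x-u)^2}{4}}H_{k,m}(\alpha,\overline\alpha),$$ with $\alpha:=\frac{u-x+i(a-\eta)}{\sqrt2}$.
   Context: Hermite functions: $h_m(t)=e^{-t^2/2}H_m(t)=(-1)^me^{t^2/2}\frac{d^m}{dt^m}(e^{-t^2})$. The 2D-complex Hermite polynomials are $H_{k,\ell}(z,w)=\sum_{j=0}^{\min(k,\ell)}(-1)^jj!\binom kj\binom\ell jz^{\ell-j}w^{k-j}$, $(z,w)\in\mathbb{C}^2$. The short-time Fourier transform of $f\in L^2(\mathbb{R})$ with window $g\in L^2(\mathbb{R})$ is $V_g(f)(x,\omega)=\int_{\mathbb{R}}e^{-it\omega}\overline{g(t-x)}f(t)\,dt$. The superoscillating sequence, $n\in\mathbb{N}$, is $F_n(t,a)=\sum_{j=0}^nC_j(n,a)e^{i(1-2j/n)t}$ with $C_j(n,a)=\binom{n}{j}\left(\frac{1+a}{2}\right)^{n-j}\left(\frac{1-a}{2}\right)^j$.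
   Formalization: The sign (-1)^m in the limit is corrected to (-1)^k; the printed formula fails when k+m is odd, e.g. k=1, m=0, a=2, x=u=η=0, where the limit is 2i√π/e but the printed formula gives -2i√π/e. *)

(* Defs.v *)
From HB Require Import structures.
From mathcomp Require Import all_boot all_order all_algebra.
From mathcomp Require Import complex.
From mathcomp Require Import all_classical all_reals all_analysis.

Set Implicit Arguments.
Unset Strict Implicit.
Unset Printing Implicit Defensive.

Import Order.TTheory GRing.Theory Num.Theory.
Import numFieldNormedType.Exports.

Local Open Scope classical_set_scope.
Local Open Scope ring_scope.
Local Open Scope complex_scope.

(* $e^{-t^2/2} H_m(t)$ with $H_m$ the physicists' Hermite polynomial given by
   the Rodrigues formula $H_m(t) = (-1)^m e^{t^2} (d/dt)^m e^{-t^2}$. *)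
Definition hermite_fun (R : realType) (m : nat) (t : R) : R :=
  (-1) ^+ m * expR (t ^+ 2 / 2) * derive1n m (fun s : R => expR (- s ^+ 2)) t.

(* The first index [k] goes with the powers of [w], the second with those of
   [z].  With this convention the time-frequency correlation of the Hermite
   functions of orders [k] (window) and [m] (signal) carries the sign
   $(-1)^k$, not $(-1)^m$, in front of $H_{k,m}(\alpha, \bar\alpha)$ for
   $\alpha = (u - x + i (a - \eta))/\sqrt 2$: for $k = 1$, $m = 0$ the
   integral of $2 (t - u) e^{i (a - \eta) t}$ against the product of Gaussians
   is $x - u + i (a - \eta) = - \sqrt 2 \bar\alpha$ times the Gaussian
   factor, and $H_{1,0}(\alpha, \bar\alpha) = \bar\alpha$. *)
Definition complex_hermite (R : realType) (k l : nat) (z w : R[i]) : R[i] :=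
  \sum_(0 <= j < (minn k l).+1)
    (-1) ^+ j * (j`! * 'C(k, j) * 'C(l, j))%N%:R * z ^+ (l - j) * w ^+ (k - j).

Definition expC (R : realType) (z : R[i]) : R[i] :=
  (expR (complex.Re z))%:C * (cos (complex.Im z) +i* sin (complex.Im z)).

(* Integral over the real line of a complex-valued function, componentwise
   with respect to Lebesgue measure. *)
Definition integralC (R : realType) (f : R -> R[i]) : R[i] :=
  Rintegral (@lebesgue_measure R) setT (fun t => complex.Re (f t))
  +i* Rintegral (@lebesgue_measure R) setT (fun t => complex.Im (f t)).

(* Window first: [stft g f x w] is $V_g(f)(x, \omega)$. *)
Definition stft (R : realType) (g f : R -> R[i]) (x w : R) : R[i] :=
  integralC (fun t => expC (- ('i * (t * w)%:C)) * (g (t - x))^* * f t).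

Definition superosc_coef (R : realType) (j n : nat) (a : R) : R :=
  'C(n, j)%:R * ((1 + a) / 2) ^+ (n - j) * ((1 - a) / 2) ^+ j.

(* At [n = 0] the only frequency is $1 - 0/0 = 1$, as [x / 0 = 0]. *)
Definition superosc (R : realType) (n : nat) (t a : R) : R[i] :=
  \sum_(0 <= j < n.+1)
    (superosc_coef j n a)%:C * expC ('i * ((1 - 2 * j%:R / n%:R) * t)%:C).

Definition superosc_signal (R : realType) (m n : nat) (x a t : R) : R[i] :=
  (hermite_fun m (t - x))%:C * superosc n t a.

(* Main.v *)
Require Import Defs.
From mathcomp Require Import all_boot all_order all_algebra.
From mathcomp Require Import complex.
From mathcomp Require Import zify ring lra.
From mathcomp Require Import all_classical all_reals all_analysis.
From mathcomp Require Import measurable_realfun.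

(** For [n > 0] the superoscillating function is an [n]-th power,
    [F_n(t) = (cos (t / n) + i a sin (t / n)) ^ n], by the binomial theorem.
    Hence it is bounded by [exp (a |t|)] uniformly in [n] ([normc_superosc]), and
    it tends pointwise to [exp (i a t)] ([cvg_superosc]), because
    [cos s + i a sin s] and [exp (i a s)] agree up to [O(s ^ 2)]. The integrand
    of the short-time Fourier transform is a polynomial times a Gaussian times
    [F_n]; the Gaussian absorbs [exp (a |t|)], so by dominated convergence the
    limit is the same transform with [F_n] replaced by [exp (i a t)]
    ([cvg_gauss_poly_superosc]).

    It remains to compute the integral [gauss_int c p] of [p(t) exp (c t - t ^ 2)]
    for [c = u + x + i (a - eta)], where [p] is a product of Hermite polynomials
    translated by [u] and [x]. Integration by parts says that [gauss_int c]
    annihilates [p' + (c - 2 X) p] ([gauss_int_ibp]). On Hermite products this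
    yields a recursion ([gauss_int_hermiteS]) which, with [2 u - c] and [c - 2 x]
    written as multiples by the square root of 2 of the conjugate of [alpha] and
    of [alpha], is the recursion
    [H_(k+1,m) = w H_(k,m) - m H_(k,m-1)] of the complex Hermite polynomials
    ([complex_hermiteSl]). There remains [gauss_int c 1], which is
    [sqrt pi * exp (c ^ 2 / 4)] ([gauss_int1]): the integral
    of [exp (s c t - t ^ 2)] solves a linear differential equation in [s]. *)

Import Order.TTheory GRing.Theory Num.Theory.
Import numFieldNormedType.Exports.
Local Open Scope classical_set_scope.
Local Open Scope ring_scope.
Local Open Scope complex_scope.
Set Implicit Arguments.
Unset Strict Implicit.
Import Normc.

(** * Complex exponential and modulus *)

Section ComplexExp.
Variable R : realType.
Implicit Types (z w : R[i]) (x y : R).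

Lemma cReM z w : complex.Re (z * w) =
  complex.Re z * complex.Re w - complex.Im z * complex.Im w.
Proof. by case: z w => [? ?] [? ?]. Qed.

Lemma cImM z w : complex.Im (z * w) =
  complex.Re z * complex.Im w + complex.Im z * complex.Re w.
Proof. by case: z w => [? ?] [? ?]. Qed.

Lemma cReD z w : complex.Re (z + w) = complex.Re z + complex.Re w.
Proof. by case: z w => [? ?] [? ?]. Qed.

Lemma cImD z w : complex.Im (z + w) = complex.Im z + complex.Im w.
Proof. by case: z w => [? ?] [? ?]. Qed.

Lemma cReN z : complex.Re (- z) = - complex.Re z.
Proof. by case: z => [? ?]. Qed.

Lemma cImN z : complex.Im (- z) = - complex.Im z.
Proof. by case: z => [? ?]. Qed.

Lemma Re_expC z : complex.Re (expC z) = expR (complex.Re z) * cos (complex.Im z).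
Proof. by rewrite /expC cReM /= mul0r subr0. Qed.

Lemma Im_expC z : complex.Im (expC z) = expR (complex.Re z) * sin (complex.Im z).
Proof. by rewrite /expC cImM /= mul0r addr0. Qed.

Lemma complex_ext z w :
  complex.Re z = complex.Re w -> complex.Im z = complex.Im w -> z = w.
Proof. by case: z w => [a b] [c d] /= -> ->. Qed.

Lemma expC0 : expC (0 : R[i]) = 1.
Proof.
by apply: complex_ext; rewrite ?(Re_expC, Im_expC) /= expR0 ?cos0 ?sin0 ?mulr1 ?mulr0.
Qed.

Lemma expCD z w : expC (z + w) = expC z * expC w.
Proof.
apply: complex_ext.
  by rewrite Re_expC (cReM (expC z)) !Re_expC !Im_expC cReD cImD expRD cosD; ring.
by rewrite Im_expC (cImM (expC z)) !Re_expC !Im_expC cReD cImD expRD sinD; ring.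
Qed.

Lemma expC_mulrn z n : expC (z *+ n) = expC z ^+ n.
Proof.
by elim: n => [|n IH]; rewrite ?mulr0n ?expr0 ?expC0// mulrS exprS expCD IH.
Qed.

Lemma expC_real x : expC x%:C = (expR x)%:C.
Proof.
by apply: complex_ext; rewrite ?(Re_expC, Im_expC) /= ?cos0 ?sin0 ?mulr1 ?mulr0.
Qed.

Lemma normcE2 z :
  normc z = Num.sqrt (complex.Re z ^+ 2 + complex.Im z ^+ 2).
Proof. by case: z. Qed.

Lemma normc_ge0 z : 0 <= normc z.
Proof. by rewrite normcE2 sqrtr_ge0. Qed.

Lemma Re_le_normc z : `|complex.Re z| <= normc z.
Proof. by rewrite normcE2 -sqrtr_sqr ler_wsqrtr// lerDl sqr_ge0. Qed.

Lemma Im_le_normc z : `|complex.Im z| <= normc z.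
Proof. by rewrite normcE2 -sqrtr_sqr ler_wsqrtr// lerDr sqr_ge0. Qed.

Lemma normc_real x : normc x%:C = `|x|.
Proof. by rewrite normcE2 /= expr0n addr0 sqrtr_sqr. Qed.

Lemma normc_le_ReIm z : normc z <= `|complex.Re z| + `|complex.Im z|.
Proof.
rewrite normcE2 -[leRHS]ger0_norm ?addr_ge0// -sqrtr_sqr ler_wsqrtr//.
rewrite sqrrD !real_normK ?num_real// -addrA lerD2l lerDr mulrn_wge0//.
Qed.

Lemma normc_expC z : normc (expC z) = expR (complex.Re z).
Proof.
rewrite normcE2 Re_expC Im_expC !exprMn -mulrDr cos2Dsin2 mulr1 sqrtr_sqr.
by rewrite ger0_norm ?expR_ge0.
Qed.

Lemma normcX z n : normc (z ^+ n) = normc z ^+ n.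
Proof. by elim: n => [|n IH]; rewrite ?normc1// !exprS normcM IH. Qed.

(** The norm of [R[i]] takes its values in [R[i]], so the radius of a
    neighbourhood is a complex number; it is positive, hence real, and this
    brings convergence in the modulus metric down to the two real components. *)
Lemma cvgC (u : nat -> R[i]) (l : R[i]) :
  complex.Re (u n) @[n --> \oo] --> complex.Re l ->
  complex.Im (u n) @[n --> \oo] --> complex.Im l ->
  (u n : R[i]^o) @[n --> \oo] --> (l : R[i]^o).
Proof.
move=> /cvgrPdist_lt hr /cvgrPdist_lt hi.
apply/cvgrPdist_lt => e; rewrite ltcE /= => /andP[/eqP ei er].
have e2 : 0 < complex.Re e / 2 by rewrite divr_gt0.
have := hr _ e2; have := hi _ e2; apply: filterS2 => n hin hrn.
have -> : e = (complex.Re e)%:C by apply: complex_ext.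
rewrite -[`|_|]/((normc (l - u n))%:C) ltcR.
rewrite (le_lt_trans (normc_le_ReIm _))// [ltRHS]splitr.
by rewrite ltrD// ?cReD ?cImD ?cReN ?cImN.
Qed.

Lemma cvg_ReIm (u : nat -> R[i]) (l : R[i]) :
  normc (u n - l) @[n --> \oo] --> (0:R) ->
  complex.Re (u n) @[n --> \oo] --> complex.Re l /\
  complex.Im (u n) @[n --> \oo] --> complex.Im l.
Proof.
move=> /cvgr0Pnorm_lt h; split; apply/cvgrPdist_lt => e e0;
  have := h _ e0; apply: filterS => n; rewrite ger0_norm ?normc_ge0//;
  apply: le_lt_trans; rewrite distrC.
  by rewrite -cReN -cReD Re_le_normc.
by rewrite -cImN -cImD Im_le_normc.
Qed.
End ComplexExp.

(** * Domination by a Gaussian *)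

Section RealAnalysis.
Variable R : realType.
Notation mu := (@lebesgue_measure R).
Implicit Types (f g : R -> R) (t C M : R).

(** Half of the decay of [exp (- t ^ 2)]: it is integrable, and the other half
    absorbs every polynomial and every exponential factor, so that multiples of
    this one function dominate all the integrands below. *)
Definition half_gauss t := expR (- (t ^+ 2 / 2)).

Lemma integrable_half_gauss : mu.-integrable setT (EFin \o half_gauss).
Proof.
(* Up to the normalising peak this is the standard normal density. *)
have := integrable_normal_pdf (0 : R) 1.
move=> /(integrableZl measurableT (normal_peak (1:R))^-1); apply: eq_integrable => // t _.
rewrite /= normal_pdfE ?oner_neq0// /normal_fun -EFinM.
rewrite mulKf ?gt_eqF ?normal_peak_gt0 ?oner_neq0//.
by rewrite subr0 expr1n mulNr.
Qed.

Lemma integrable_half_gauss_dom f C : measurable_fun setT f ->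
  (forall t, `|f t| <= C * half_gauss t) -> mu.-integrable setT (EFin \o f).
Proof.
move=> mf fC.
have := integrableZl measurableT C integrable_half_gauss.
apply: le_integrable => //; first exact/measurable_EFinP.
move=> t _ /=; rewrite lee_fin (le_trans (fC t))//.
exact: ler_norm.
Qed.

Lemma Rintegral_half_gauss_cvg (F : nat -> R -> R) f C :
  (forall n, measurable_fun setT (F n)) ->
  (forall t, F n t @[n --> \oo] --> f t) ->
  (forall n t, `|F n t| <= C * half_gauss t) ->
  \int[mu]_t F n t @[n --> \oo] --> \int[mu]_t f t.
Proof.
move=> mF Ff FC.
have iC := integrableZl measurableT C integrable_half_gauss.
have mf : measurable_fun setT f.
  by apply: (measurable_fun_cvg mF) => t _; exact: Ff.
have mFE n : measurable_fun setT (EFin \o F n) by exact/measurable_EFinP.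
have mfE : measurable_fun setT (EFin \o f) by exact/measurable_EFinP.
have aecvg : {ae mu, forall t, setT t ->
    (EFin \o F n) t @[n --> \oo] --> (EFin \o f) t}.
  by apply: aeW => t _; apply: cvg_EFin; [exact: nearW|exact: Ff].
have aedom : {ae mu, forall t n, setT t ->
    (`|(EFin \o F n) t| <= C%:E * (half_gauss t)%:E)%E}.
  by apply: aeW => t n _; rewrite /= lee_fin; exact: FC.
have [intf _ cf] :=
  @dominated_convergence _ _ _ mu _ measurableT _ _ _ mFE mfE aecvg iC aedom.
apply: fine_cvg; rewrite fineK//.
exact: integrable_fin_num.
Qed.

(** A crude decay rate is enough for boundary terms to vanish: by
    [1 + y <= exp y] the value at [n] is at most [1 / (1 + n ^ 2 / 2)]. *)
Lemma half_gauss_le_harmonic n t : `|t| = n%:R -> half_gauss t <= 2 * harmonic n.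
Proof.
move=> tn; rewrite /half_gauss /harmonic -[t ^+ 2]real_normK ?num_real// tn expRN.
have h : (n.+1%:R / 2 : R) <= expR (n%:R ^+ 2 / 2).
  apply: le_trans (expR_ge1Dx _).
  rewrite -natr1; have := sqr_ge0 (n%:R - 1 : R); rewrite sqrrB1; nra.
rewrite -[leLHS]invrK -[leRHS]invrK invrK lef_pV2 ?posrE ?expR_gt0//; last first.
  by rewrite invr_gt0 mulr_gt0// invr_gt0 ltr0n.
by rewrite invfM invrK mulrC.
Qed.

(** The boundary terms of the fundamental theorem of calculus on [[-n, n]] tend
    to 0, and dominated convergence passes from [[-n, n]] to the line. This is
    integration by parts on the line. *)
Lemma Rintegral_derivative_eq0 f f' C :
  (forall t, is_derive t 1 f (f' t)) -> continuous f' ->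
  (forall t, `|f t| <= C * half_gauss t) ->
  (forall t, `|f' t| <= C * half_gauss t) ->
  \int[mu]_t f' t = 0.
Proof.
move=> df cf' fC f'C.
have C0 : 0 <= C.
  have := le_trans (normr_ge0 _) (fC 0).
  by rewrite pmulr_lge0// /half_gauss expR_gt0.
pose I n : set R := `[- n%:R, n%:R]%classic.
have cvgI : \int[mu]_t (f' \_ (I n)) t @[n --> \oo] --> \int[mu]_t f' t.
  apply: (@Rintegral_half_gauss_cvg _ _ C).
  - move=> n; apply/measurable_restrict => //; first exact: measurable_itv.
    by rewrite setTI; apply: measurable_funTS; exact: continuous_measurable_fun.
  - move=> t; apply: cvg_near_cst; near=> n.
    rewrite patchE mem_set// /I /= in_itv/= -ler_norml.
    near: n; exact: nbhs_infty_ger.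
  - move=> n t; rewrite patchE; case: ifPn => _; first exact: f'C.
    by rewrite normr0 mulr_ge0// expR_ge0.
have intI n : \int[mu]_t (f' \_ (I n.+1)) t = f n.+1%:R - f (- n.+1%:R).
  rewrite -Rintegral_mkcond /Rintegral (@continuous_FTC2 _ _ f)//.
  - by rewrite (lt_le_trans (_ : _ < 0))// oppr_lt0.
  - exact: continuous_subspaceT.
  - have cf : continuous f.
      by move=> t; apply/differentiable_continuous/derivable1_diffP; have [] := df t.
    split; first by move=> t _; have [] := df t.
      by apply/cvg_at_right_filter/cf.
    by apply/cvg_at_left_filter/cf.
  - by move=> t _; rewrite derive1E; have [] := df t.
have /cvg_unique : (fun n => \int[mu]_t (f' \_ (I n.+1)) t) @ \oo --> \int[mu]_t f' t.
  by rewrite (cvg_shiftS (fun n => \int[mu]_t (f' \_ (I n)) t)).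
apply => //.
rewrite /mkset (_ : (fun n => \int[mu]_t (f' \_ (I n.+1)) t) =
  (fun n => f n.+1%:R - f (- n.+1%:R))); last exact/funext.
apply: norm_cvg0.
apply: (@squeeze_cvgr _ _ _ _ (cst 0) (fun n => C * (2 * harmonic n.+1) + C * (2 * harmonic n.+1))).
- apply: nearW => n; rewrite normr_ge0/=.
  rewrite (le_trans (ler_normB _ _))// lerD// (le_trans (fC _))// ler_wpM2l//.
    by rewrite half_gauss_le_harmonic// ger0_norm.
  by rewrite half_gauss_le_harmonic// normrN ger0_norm.
- exact: cvg_cst.
- have h : C * (2 * harmonic n.+1) @[n --> \oo] --> (C * (2 * 0) : R).
    apply: cvgMl_tmp; apply: cvgMl_tmp.
    by rewrite (cvg_shiftS (@harmonic R)); exact: cvg_harmonic.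
  have -> : (0 : R) = C * (2 * 0) + C * (2 * 0) by rewrite !mulr0 addr0.
  exact: cvgD.
Unshelve. all: end_near. Qed.

(** Differentiation under the integral sign, with the domination needed only
    in the unit neighbourhood of the point: the bounds for the Gaussian
    integrals are only locally uniform in the parameter. *)
Lemma is_derive_Rintegral (f f' : R -> R -> R) (s : R) C :
  (forall r t : R, is_derive r 1 (f ^~ t) (f' r t)) ->
  (forall r : R, measurable_fun setT (f r)) ->
  (forall r t : R, `|r - s| < 1 -> `|f r t| <= C * half_gauss t) ->
  (forall r t : R, `|r - s| < 1 -> `|f' r t| <= C * half_gauss t) ->
  is_derive s 1 (fun r => \int[mu]_t f r t) (\int[mu]_t f' s t).
Proof.
move=> df mf fC f'C.
have C0 : 0 <= C.
  have := le_trans (normr_ge0 _) (fC s 0 _).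
  by rewrite subrr normr0 ltr01 => /(_ isT); rewrite pmulr_lge0// expR_gt0.
have d1E : partial1of2 f = f'.
  by apply/funext => r; apply/funext => t; rewrite partial1of2E; have [] := df r t.
have nears r : `]s - 1, s + 1[%classic r -> `|r - s| < 1.
  by rewrite /= in_itv /= => /andP[sr rs]; rewrite ltr_norml; apply/andP; split; lra.
have Is : `]s - 1, s + 1[%classic s.
  by rewrite /= in_itv/= ltrDl ltr01 ltrBlDr ltrDl ltr01.
have intf r : `]s - 1, s + 1[%classic r -> mu.-integrable setT (EFin \o f r).
  by move=> /nears rs; apply: (@integrable_half_gauss_dom _ C) => // t; exact: fC.
have dfr r t : `]s - 1, s + 1[%classic r -> setT t -> derivable (f ^~ t) r 1.
  by move=> _ _; have [] := df r t.
have ge0G t : 0 <= C * half_gauss t by rewrite mulr_ge0// expR_ge0.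
have iG : mu.-integrable setT (EFin \o (fun t => C * half_gauss t)).
  by have := integrableZl measurableT C integrable_half_gauss.
have f'G r t : `]s - 1, s + 1[%classic r -> setT t ->
    `|partial1of2 f r t| <= C * half_gauss t.
  by move=> /nears rs _; rewrite d1E; exact: f'C.
apply: DeriveDef.
  exact: (@derivable_under_integral _ _ _ mu f _ measurableT _ _ _ Is intf dfr _ ge0G iG f'G).
rewrite -derive1E.
rewrite (@differentiation_under_integral _ _ _ mu f _ measurableT _ _ _ Is intf dfr _ ge0G iG f'G).
by rewrite d1E.
Qed.

End RealAnalysis.

(** * Integrals of polynomials against a Gaussian *)

Section GaussPoly.
Variable R : realType.
Notation mu := (@lebesgue_measure R).
Implicit Types (p q : {poly R[i]}) (c z : R[i]) (t : R).

(** Differentiability of a curve in the complex plane, taken componentwise to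
    match the componentwise definition of the complex integral. *)
Definition is_deriveC (f : R -> R[i]) (t : R) (l : R[i]) :=
  is_derive t 1 (fun s => complex.Re (f s)) (complex.Re l) /\
  is_derive t 1 (fun s => complex.Im (f s)) (complex.Im l).

Lemma is_deriveC_eq (f : R -> R[i]) t l l' :
  is_deriveC f t l -> l = l' -> is_deriveC f t l'.
Proof. by move=> ? <-. Qed.

Lemma is_deriveC_cst z t : is_deriveC (fun=> z) t 0.
Proof. by split; exact: is_derive_cst. Qed.

Lemma is_deriveC_id t : is_deriveC (fun s => s%:C) t 1.
Proof. by split => /=; [exact: is_derive_id|exact: is_derive_cst]. Qed.

Lemma is_deriveCD (f g : R -> R[i]) t l m : is_deriveC f t l ->
  is_deriveC g t m -> is_deriveC (fun s => f s + g s) t (l + m).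
Proof.
move=> [fr fi] [gr gi]; split.
  rewrite cReD (_ : (fun _ => _) =
    (fun s => complex.Re (f s)) + (fun s => complex.Re (g s))); last first.
    by apply/funext => s; rewrite cReD.
  exact: is_deriveD.
rewrite cImD (_ : (fun _ => _) =
  (fun s => complex.Im (f s)) + (fun s => complex.Im (g s))); last first.
  by apply/funext => s; rewrite cImD.
exact: is_deriveD.
Qed.

Lemma is_deriveCM (f g : R -> R[i]) t l m : is_deriveC f t l ->
  is_deriveC g t m -> is_deriveC (fun s => f s * g s) t (l * g t + f t * m).
Proof.
move=> [fr fi] [gr gi]; split.
  rewrite (_ : (fun _ => _) =
    (fun s => complex.Re (f s)) * (fun s => complex.Re (g s)) -
    (fun s => complex.Im (f s)) * (fun s => complex.Im (g s))); last first.
    by apply/funext => s; rewrite cReM.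
  apply: is_derive_eq; rewrite cReD !cReM /GRing.scale/=; ring.
rewrite (_ : (fun _ => _) =
  (fun s => complex.Re (f s)) * (fun s => complex.Im (g s)) +
  (fun s => complex.Im (f s)) * (fun s => complex.Re (g s))); last first.
  by apply/funext => s; rewrite cImM.
by apply: is_derive_eq; rewrite cImD !cImM /GRing.scale/=; ring.
Qed.

Lemma is_deriveC_horner p t :
  is_deriveC (fun s => p.[s%:C]) t p^`().[t%:C].
Proof.
elim/poly_ind: p => [|p z IH].
  by under eq_fun do rewrite horner0; rewrite deriv0 horner0; exact: is_deriveC_cst.
rewrite (_ : (fun s => _) = (fun s => p.[s%:C] * s%:C + z)); last first.
  by apply/funext => s; rewrite !hornerE.
apply: is_deriveC_eq.
  apply: is_deriveCD; last exact: is_deriveC_cst.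
  exact: is_deriveCM IH (is_deriveC_id t).
by rewrite derivMXaddC !hornerE; ring.
Qed.

Lemma is_deriveC_expC (f : R -> R[i]) t l : is_deriveC f t l ->
  is_deriveC (fun s => expC (f s)) t (l * expC (f t)).
Proof.
move=> [fr fi].
have er := @is_derive1_comp _ expR (fun s => complex.Re (f s)) t _ _ (is_derive_expR _) fr.
have ci := @is_derive1_comp _ cos (fun s => complex.Im (f s)) t _ _ (is_derive_cos _) fi.
have si := @is_derive1_comp _ sin (fun s => complex.Im (f s)) t _ _ (is_derive_sin _) fi.
split.
  rewrite (_ : (fun _ => _) = (expR \o (fun s => complex.Re (f s))) *
    (cos \o (fun s => complex.Im (f s)))); last first.
    by apply/funext => s; rewrite Re_expC.
  by apply: is_derive_eq; rewrite (cReM l) Re_expC Im_expC /GRing.scale/=; ring.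
rewrite (_ : (fun _ => _) = (expR \o (fun s => complex.Re (f s))) *
  (sin \o (fun s => complex.Im (f s)))); last first.
  by apply/funext => s; rewrite Im_expC.
by apply: is_derive_eq; rewrite (cImM l) Re_expC Im_expC /GRing.scale/=; ring.
Qed.

Lemma is_deriveC_continuous (f f' : R -> R[i]) :
  (forall t, is_deriveC f t (f' t)) ->
  continuous (fun t => complex.Re (f t)) /\ continuous (fun t => complex.Im (f t)).
Proof.
move=> df; split=> t; apply/differentiable_continuous/derivable1_diffP;
  by have [[] + _ [] + _] := df t.
Qed.

Lemma is_deriveC_0_cst (f : R -> R[i]) (s t : R) :
  (forall t, is_deriveC f t 0) -> f s = f t.
Proof.
move=> df; apply: complex_ext.
  by apply: (@is_derive_0_is_cst _ (fun t => complex.Re (f t))) => r; have [] := df r.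
by apply: (@is_derive_0_is_cst _ (fun t => complex.Im (f t))) => r; have [] := df r.
Qed.

(** The form that the integrands take once the superoscillating factor is
    replaced by its limit: the phase, the translations and the modulations are
    collected in [c], and the constants and the Hermite factors in [p]. *)
Definition gauss_poly c p t := p.[t%:C] * expC (c * t%:C - (t ^+ 2)%:C).

(** The class of polynomials times a fixed Gaussian is stable under
    differentiation; the operator induced on the polynomial is what integration
    by parts sees. *)
Lemma is_deriveC_gauss_poly c p t :
  is_deriveC (gauss_poly c p) t (gauss_poly c (p^`() + (c%:P - 'X *+ 2) * p) t).
Proof.
have dexp : is_deriveC (fun s => expC (c * s%:C - (s ^+ 2)%:C)) t
    ((c - t%:C *+ 2) * expC (c * t%:C - (t ^+ 2)%:C)).
  apply: is_deriveC_expC.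
  rewrite (_ : (fun s : R => _) = (fun s => c * s%:C + (-1) * (s%:C * s%:C))); last first.
    by apply/funext => s; rewrite mulN1r -rmorphM -expr2.
  apply: is_deriveC_eq.
    apply: is_deriveCD; apply: is_deriveCM; [exact: is_deriveC_cst|exact: is_deriveC_id|
      exact: is_deriveC_cst|].
    by apply: is_deriveCM; exact: is_deriveC_id.
  by cbv beta; ring.
apply: is_deriveC_eq; first exact: is_deriveCM (is_deriveC_horner p t) dexp.
by rewrite /gauss_poly hornerD hornerM hornerD hornerN hornerMn hornerC hornerX; ring.
Qed.

Lemma half_gauss_common (C D : R) :
  (forall t, C * half_gauss t <= (`|C| + `|D|) * half_gauss t) /\
  (forall t, D * half_gauss t <= (`|C| + `|D|) * half_gauss t).
Proof.
by split=> t; rewrite ler_wpM2r ?expR_ge0// (le_trans (ler_norm _))// ?lerDl ?lerDr.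
Qed.

(** Completing the square, [(M - |t|) ^ 2 >= 0]. *)
Lemma half_gauss_absorb (M : R) t :
  expR (M * `|t| - t ^+ 2) <= expR (M ^+ 2 / 2) * half_gauss t.
Proof.
rewrite /half_gauss -expRD ler_expR -[t ^+ 2]real_normK ?num_real//.
have := sqr_ge0 (M - `|t|); nra.
Qed.

(** A polynomial is bounded by a multiple of [exp (N |t|)] for some [N], since
    [|t| <= exp |t|], and the Gaussian absorbs this exponential. *)
Lemma poly_half_gauss_bound p (M : R) : exists C, forall t,
  normc p.[t%:C] * expR (M * `|t| - t ^+ 2) <= C * half_gauss t.
Proof.
suff [C [N [C0 N0 CN]]] : exists C N : R, [/\ 0 <= C, 0 <= N &
    forall t, normc p.[t%:C] <= C * expR (N * `|t|)].
  exists (C * expR ((N + M) ^+ 2 / 2)) => t.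
  rewrite -mulrA (le_trans _ (ler_wpM2l C0 (half_gauss_absorb _ t)))//.
  by rewrite mulrDl -addrA (expRD (N * _)) mulrA ler_wpM2r ?expR_ge0.
elim/poly_ind: p => [|p z [C [N [C0 N0 CN]]]].
  exists 0, 0; split => // t; by rewrite horner0 normc0 mul0r.
exists (C + normc z), (N + 1); split; rewrite ?addr_ge0 ?normc_ge0// => t.
rewrite !hornerE (le_trans (le_normcD _ _))// mulrDl lerD//.
  rewrite normcM normc_real mulrDl mul1r expRD mulrA ler_pM ?normc_ge0//.
  by rewrite (le_trans _ (expR_ge1Dx _))// lerDr.
by rewrite ler_peMr ?normc_ge0// -expR0 ler_expR mulr_ge0// addr_ge0.
Qed.

Lemma normc_gauss_exp_le c (s M : R) t : `|s| <= M ->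
  normc (expC (s%:C * c * t%:C - (t ^+ 2)%:C)) <=
  expR (M * `|complex.Re c| * `|t| - t ^+ 2).
Proof.
move=> sM; rewrite normc_expC ler_expR cReD cReN !cReM /=.
rewrite mulr0 subr0 mul0r subr0 lerD2r (le_trans (ler_norm _))// !normrM.
by rewrite ler_wpM2r// ler_wpM2r.
Qed.

(** The bound is uniform for [s] in a bounded set, which serves the
    differentiation in [s], and leaves room for a factor [exp (M |t|)], which
    serves the superoscillating factor. *)
Lemma gauss_poly_bound c p (M N : R) : exists C, forall s t, `|s| <= N ->
  normc (gauss_poly (s%:C * c) p t) * expR (M * `|t|) <= C * half_gauss t.
Proof.
have [C hC] := poly_half_gauss_bound p (N * `|complex.Re c| + M).
exists C => s t sN; rewrite (le_trans _ (hC t))// /gauss_poly normcM -mulrA.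
rewrite ler_wpM2l ?normc_ge0// mulrDl -addrA [M * _ - _]addrC addrA (expRD _ (M * _)).
by rewrite ler_wpM2r ?expR_ge0// normc_gauss_exp_le.
Qed.

Lemma gauss_poly_bound1 c p : exists C, forall t, normc (gauss_poly c p t) <= C * half_gauss t.
Proof.
have [C hC] := gauss_poly_bound c p 0 1; exists C => t.
by have := hC 1 t; rewrite normr1 lexx mul1r mul0r expR0 mulr1; exact.
Qed.

Lemma continuous_gauss_poly c p : continuous (fun t => complex.Re (gauss_poly c p t)) /\
  continuous (fun t => complex.Im (gauss_poly c p t)).
Proof. exact: is_deriveC_continuous (is_deriveC_gauss_poly c p). Qed.

Lemma integrable_gauss_poly c p :
  mu.-integrable setT (EFin \o (fun t => complex.Re (gauss_poly c p t))) /\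
  mu.-integrable setT (EFin \o (fun t => complex.Im (gauss_poly c p t))).
Proof.
have [C hC] := gauss_poly_bound1 c p; have [cr ci] := continuous_gauss_poly c p.
split; apply: (@integrable_half_gauss_dom _ _ C); try exact: continuous_measurable_fun.
  by move=> t; exact: le_trans (Re_le_normc _) (hC t).
by move=> t; exact: le_trans (Im_le_normc _) (hC t).
Qed.

(** As a linear functional of [p], this is determined by its value at 1: see
    [gauss_int_ibp]. *)
Definition gauss_int c p : R[i] := integralC (gauss_poly c p).

Lemma gauss_intD c p q : gauss_int c (p + q) = gauss_int c p + gauss_int c q.
Proof.
have [pr pi] := integrable_gauss_poly c p; have [qr qi] := integrable_gauss_poly c q.
apply: complex_ext; rewrite ?(cReD, cImD) /=.
  rewrite -RintegralD//; apply: eq_Rintegral => t _.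
  by rewrite /gauss_poly hornerD mulrDl cReD.
rewrite -RintegralD//; apply: eq_Rintegral => t _.
by rewrite /gauss_poly hornerD mulrDl cImD.
Qed.

Lemma gauss_intZ c z p : gauss_int c (z *: p) = z * gauss_int c p.
Proof.
have [pr pi] := integrable_gauss_poly c p.
have Zr (r : R) f : mu.-integrable setT (EFin \o f) ->
    mu.-integrable setT (EFin \o (fun t => r * f t)).
  by move=> /(integrableZl measurableT r).
apply: complex_ext; rewrite ?(cReM, cImM) /=.
  rewrite -!RintegralZl// -RintegralB//; [|exact: Zr..].
  by apply: eq_Rintegral => t _; rewrite /gauss_poly hornerZ -mulrA cReM.
rewrite -!RintegralZl// -RintegralD//; [|exact: Zr..].
by apply: eq_Rintegral => t _; rewrite /gauss_poly hornerZ -mulrA cImM.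
Qed.

(** The argument is the polynomial factor of the derivative of [gauss_poly c p], so
    its integral vanishes. *)
Lemma gauss_int_ibp c p : gauss_int c (p^`() + (c%:P - 'X *+ 2) * p) = 0.
Proof.
set q := _ + _.
have [C hC] := gauss_poly_bound1 c p; have [D hD] := gauss_poly_bound1 c q.
have [cr ci] := continuous_gauss_poly c q.
have [hgC hgD] := half_gauss_common C D.
apply: complex_ext => /=.
  apply: (@Rintegral_derivative_eq0 _ (fun t => complex.Re (gauss_poly c p t)) _ (`|C| + `|D|)) => //.
  - by move=> t; have [] := is_deriveC_gauss_poly c p t.
  - by move=> t; rewrite (le_trans (Re_le_normc _))// (le_trans (hC t)).
  - by move=> t; rewrite (le_trans (Re_le_normc _))// (le_trans (hD t)).
apply: (@Rintegral_derivative_eq0 _ (fun t => complex.Im (gauss_poly c p t)) _ (`|C| + `|D|)) => //.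
- by move=> t; have [] := is_deriveC_gauss_poly c p t.
- by move=> t; rewrite (le_trans (Im_le_normc _))// (le_trans (hC t)).
- by move=> t; rewrite (le_trans (Im_le_normc _))// (le_trans (hD t)).
Qed.

Lemma is_deriveC_gauss_int c (s : R) :
  is_deriveC (fun s => gauss_int (s%:C * c) 1) s (c * gauss_int (s%:C * c) 'X).
Proof.
rewrite -gauss_intZ.
have [C hC] := gauss_poly_bound c 1 0 (`|s| + 1).
have [D hD] := gauss_poly_bound c (c *: 'X) 0 (`|s| + 1).
have [hgC hgD] := half_gauss_common C D.
have near (r : R) : `|r - s| < 1 -> `|r| <= `|s| + 1.
  move=> /ltW rs; rewrite -[r](subrK s) (le_trans (ler_normD _ _))//.
  by rewrite addrC lerD2l.
have dg (r t : R) : is_deriveC (fun r => gauss_poly (r%:C * c) 1 t) r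
    (gauss_poly (r%:C * c) (c *: 'X) t).
  rewrite /gauss_poly hornerC.
  rewrite (_ : (fun r : R => _) =
    (fun r => expC (c * t%:C * r%:C - (t ^+ 2)%:C))); last first.
    by apply/funext => r'; rewrite mul1r; congr expC; ring.
  apply: is_deriveC_eq.
    apply: is_deriveC_expC; apply: is_deriveCD; last exact: is_deriveC_cst.
    by apply: is_deriveCM; [exact: is_deriveC_cst|exact: is_deriveC_id].
  rewrite hornerZ hornerX; set e := expC _; set e' := expC _; have -> : e = e'.
    by congr expC; ring.
  by cbv beta; ring.
split => /=.
  apply: (@is_derive_Rintegral _ (fun r t => complex.Re (gauss_poly (r%:C * c) 1 t))
    (fun r t => complex.Re (gauss_poly (r%:C * c) (c *: 'X) t)) s (`|C| + `|D|)).
  - by move=> r t; have [] := dg r t.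
  - by move=> r; apply: continuous_measurable_fun; have [] := continuous_gauss_poly (r%:C * c) 1.
  - move=> r t /near /(hC _ t); rewrite mul0r expR0 mulr1 => h.
    by rewrite (le_trans (Re_le_normc _))// (le_trans h).
  - move=> r t /near /(hD _ t); rewrite mul0r expR0 mulr1 => h.
    by rewrite (le_trans (Re_le_normc _))// (le_trans h).
apply: (@is_derive_Rintegral _ (fun r t => complex.Im (gauss_poly (r%:C * c) 1 t))
  (fun r t => complex.Im (gauss_poly (r%:C * c) (c *: 'X) t)) s (`|C| + `|D|)).
- by move=> r t; have [] := dg r t.
- by move=> r; apply: continuous_measurable_fun; have [] := continuous_gauss_poly (r%:C * c) 1.
- move=> r t /near /(hC _ t); rewrite mul0r expR0 mulr1 => h.
  by rewrite (le_trans (Im_le_normc _))// (le_trans h).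
- move=> r t /near /(hD _ t); rewrite mul0r expR0 mulr1 => h.
  by rewrite (le_trans (Im_le_normc _))// (le_trans h).
Qed.

Lemma gauss_int01 : gauss_int 0 1 = (Num.sqrt pi)%:C.
Proof.
apply: complex_ext => /=.
  rewrite (_ : (fun t => _) = (fun t => gauss_fun t)); last first.
    apply/funext => t; rewrite /gauss_poly hornerC mul1r mul0r sub0r Re_expC /=.
    by rewrite oppr0 cos0 mulr1.
  by rewrite /Rintegral integralT_gauss.
rewrite (_ : (fun t => _) = (fun=> 0)); last first.
  apply/funext => t; rewrite /gauss_poly hornerC mul1r mul0r sub0r Im_expC /=.
  by rewrite oppr0 sin0 mulr0.
by rewrite /Rintegral integral0.
Qed.

(** Along the ray [s * c], [0 <= s <= 1], integration by parts turns the
    derivative of the integral into [s * c ^ 2 / 2] times the integral; hence its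
    quotient by [exp (s ^ 2 c ^ 2 / 4)] is constant, and at [s = 0] it is the
    Gaussian integral. Using the ray treats real and imaginary [c] together, with
    neither a contour shift nor a translation of the variable. *)
Lemma gauss_int1 c : gauss_int c 1 = (Num.sqrt pi)%:C * expC (c ^+ 2 / 4).
Proof.
pose f s := gauss_int (s%:C * c) 1 * expC (s%:C * s%:C * (- (c ^+ 2 / 4))).
have moment s : gauss_int (s%:C * c) 'X = s%:C * c / 2 * gauss_int (s%:C * c) 1.
  (* Integration by parts with the polynomial 1: the integral of
     [(s c - 2 t) exp (s c t - t ^ 2)] is 0. *)
  have := gauss_int_ibp (s%:C * c) 1.
  rewrite derivC add0r mulr1.
  have -> : (s%:C * c)%:P - 'X *+ 2 = (s%:C * c) *: 1 + (- 2) *: 'X :> {poly R[i]}.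
    by rewrite -mul_polyC mulr1 scaleNr scaler_nat.
  rewrite gauss_intD !gauss_intZ => h.
  have -> : gauss_int (s%:C * c) 'X = (s%:C * c * gauss_int (s%:C * c) 1 -
    (s%:C * c * gauss_int (s%:C * c) 1 + - 2 * gauss_int (s%:C * c) 'X)) / 2 by field.
  by rewrite h; field.
have df s : is_deriveC f s 0.
  apply: is_deriveC_eq.
    apply: is_deriveCM; first exact: is_deriveC_gauss_int.
    apply: is_deriveC_expC; apply: is_deriveCM; last exact: is_deriveC_cst.
    by apply: is_deriveCM; exact: is_deriveC_id.
  by rewrite moment; field.
have := is_deriveC_0_cst 1 0 df; rewrite /f !mul0r expC0 mulr1 gauss_int01 !mul1r => <-.
by rewrite -mulrA -expCD addNr expC0 mulr1.
Qed.
End GaussPoly.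

(** * Hermite functions and complex Hermite polynomials *)

(** The physicists' Hermite polynomial translated by [u]. Translating inside
    the recursion makes products with different centres [u] and [x] available as
    polynomials in the same variable, over any ring. *)
Fixpoint hermite_poly (F : comNzRingType) (u : F) (k : nat) : {poly F} :=
  if k is k'.+1 then
    ('X - u%:P) *+ 2 * hermite_poly u k' - (hermite_poly u k')^`()
  else 1.

Lemma deriv_hermite_poly (F : comNzRingType) (u : F) k :
  (hermite_poly u k)^`() = k.*2%:R *: hermite_poly u k.-1.
Proof.
suff S j : (hermite_poly u j.+1)^`() = j.+1.*2%:R *: hermite_poly u j.
  by case: k => [|k]; [rewrite derivC scale0r|exact: S].
elim: j => [|j IH].
  by rewrite /= derivB derivM derivMn derivB derivX !derivC !subr0 mulr0 addr0 mulr1 scaler_nat.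
rewrite [hermite_poly u j.+2]/= -/(hermite_poly u j.+1) derivB derivM derivMn derivB derivX.
rewrite derivC subr0 IH derivZ -!mul_polyC.
rewrite [hermite_poly u j.+1]/= !doubleS -!natr1 -!addnn !natrD !polyCD polyC1.
by ring.
Qed.

Section HermiteFunctions.
Variable R : realType.
Implicit Types (t u x : R).

Lemma hermite_poly_shift u k t :
  (hermite_poly u%:C k).[t%:C] = ((hermite_poly 0 k).[t - u])%:C.
Proof.
suff -> : hermite_poly u%:C k =
    map_poly (real_complex R) (hermite_poly 0 k) \Po ('X - u%:C%:P).
  by rewrite horner_comp hornerXsubC -rmorphB horner_map.
elim: k => [|k IH] /=; first by rewrite rmorph1 comp_polyC.
set p := hermite_poly (0 : R) k in IH *.
have -> : map_poly (real_complex R) (('X - 0%:P) *+ 2 * p - p^`()) =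
    'X *+ 2 * map_poly (real_complex R) p - (map_poly (real_complex R) p)^`().
  by rewrite polyC0 subr0 rmorphB /= rmorphM /= rmorphMn /= map_polyX deriv_map.
rewrite comp_polyB comp_polyM -IH; congr (_ * _ - _).
  by rewrite mulr2n comp_polyD comp_polyX.
by rewrite IH deriv_comp derivB derivX derivC subr0 mulr1.
Qed.

Lemma derive1n_gauss m :
  derive1n m (fun s : R => expR (- s ^+ 2)) =
  (fun t => (-1) ^+ m * (hermite_poly 0 m).[t] * expR (- t ^+ 2)).
Proof.
elim: m => [|m IH].
  by apply/funext => t; rewrite derive1n0 /= hornerC mulr1 mul1r.
rewrite derive1nS IH; apply/funext => t; rewrite derive1E.
have dg : is_derive t 1 (fun s : R => expR (- s ^+ 2)) (expR (- t ^+ 2) * (- (t *+ 2))).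
  apply: (@is_derive1_comp _ expR (fun s : R => - s ^+ 2)).
  by apply: is_derive_eq; rewrite /GRing.scale/=; ring.
have dp := is_derive_poly (hermite_poly (0 : R) m) t.
set f := fun s : R => _.
have -> : f = (fun=> (-1) ^+ m) * (horner (hermite_poly (0:R) m)) *
  (fun s : R => expR (- s ^+ 2)) by [].
have [_ ->] : is_derive t 1 ((fun=> (-1) ^+ m) * (horner (hermite_poly (0:R) m)) *
  (fun s : R => expR (- s ^+ 2))) ((-1) ^+ m.+1 * (hermite_poly 0 m.+1).[t] * expR (- t ^+ 2)).
  apply: is_derive_eq; rewrite /GRing.scale/=.
  rewrite -[((fun=> _) * _) t]/((-1) ^+ m * (hermite_poly (0 : R) m).[t]) /cst.
  rewrite hornerD hornerN hornerM hornerMn hornerXsubC (exprS (-1)); ring.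
by [].
Qed.

(** The Rodrigues formula carries the factor [exp (- t ^ 2)], of which half is
    cancelled by [exp (t ^ 2 / 2)]. *)
Lemma hermite_funE m t :
  hermite_fun m t = (hermite_poly 0 m).[t] * expR (- (t ^+ 2 / 2)).
Proof.
rewrite /hermite_fun derive1n_gauss.
have -> : expR (- (t ^+ 2 / 2)) = expR (t ^+ 2 / 2) * expR (- t ^+ 2).
  by rewrite -expRD; congr expR; field.
have sgn : (-1) ^+ m * (-1) ^+ m = 1 :> R by rewrite -exprMn mulrNN mulr1 expr1n.
set E := expR (t ^+ 2 / 2); set P := _.[t]; set G := expR (- _); set e := _ ^+ m in sgn *.
have -> : e * E * (e * P * G) = e * e * (P * (E * G)) by ring.
by rewrite sgn mul1r.
Qed.
End HermiteFunctions.

Section ComplexHermite.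
Variable R : realType.
Implicit Types (z w : R[i]).

Let term k l z w j : R[i] :=
  (-1) ^+ j * (j`! * 'C(k, j) * 'C(l, j))%N%:R * z ^+ (l - j) * w ^+ (k - j).

(** The binomial coefficients vanish beyond [minn k l], so that the summation
    range may be enlarged to one which does not depend on [l]. *)
Lemma complex_hermite_widen k l z w n : (k < n)%N ->
  complex_hermite k l z w = \sum_(i < n) term k l z w i.
Proof.
move=> kn; rewrite /complex_hermite -(big_mkord xpredT (term k l z w)).
rewrite (@big_cat_nat _ _ _ (minn k l).+1 0 n)//=; last first.
  by rewrite (leq_trans _ kn)// ltnS geq_minl.
rewrite [X in _ = _ + X]big_nat_cond [X in _ = _ + X]big1 ?addr0// => j.
rewrite andbT gtn_min => /andP[/orP[kj|lj] _]; rewrite /term.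
  by rewrite (bin_small kj) muln0 mul0n mulr0 !mul0r.
by rewrite (bin_small lj) muln0 mulr0 !mul0r.
Qed.

Lemma complex_hermite0l l z w : complex_hermite 0 l z w = z ^+ l.
Proof.
rewrite (@complex_hermite_widen _ _ _ _ 1)// big_ord1 /term.
by rewrite /= !bin0 fact0 !subn0 !mulr1 mul1r.
Qed.

(** Termwise this is Pascal's rule for [k], together with the absorption
    identity [(i + 1) 'C(l, i + 1) = l 'C(l - 1, i)]. *)
Lemma complex_hermiteSl k l z w : complex_hermite k.+1 l z w =
  w * complex_hermite k l z w - l%:R * complex_hermite k l.-1 z w.
Proof.
rewrite (@complex_hermite_widen _ _ _ _ k.+2)// (@complex_hermite_widen k l _ _ k.+2)//.
rewrite (@complex_hermite_widen k l.-1 _ _ k.+1)//.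
rewrite big_ord_recl [in RHS]big_ord_recl mulrDr -addrA; congr (_ + _).
  by rewrite /term !bin0 !subn0 exprS; ring.
rewrite !mulr_sumr -sumrB; apply: eq_bigr => i _; rewrite /term lift0 subSS.
have -> : (l - i.+1 = l.-1 - i)%N by lia.
have e1 : (i.+1`! * 'C(k, i) * 'C(l, i.+1) = l * (i`! * 'C(k, i) * 'C(l.-1, i)))%N.
  rewrite factS mulnCA mul_bin_diag; lia.
have -> : (i.+1`! * 'C(k.+1, i.+1) * 'C(l, i.+1) =
    i.+1`! * 'C(k, i.+1) * 'C(l, i.+1) + l * (i`! * 'C(k, i) * 'C(l.-1, i)))%N.
  by rewrite -e1 binS mulnDr mulnDl.
rewrite natrD (natrM _ l) exprS.
(* At [i = k] the exponent [k - i.+1] is truncated, but then its coefficient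
   vanishes. *)
have [ik|ki] := ltnP i k.
  by rewrite -(subnSK ik) exprS; ring.
by rewrite (bin_small (_ : (k < i.+1)%N))// muln0 mul0n; ring.
Qed.

End ComplexHermite.

Section GaussHermite.
Variable R : realType.
Implicit Types (c z w : R[i]).

(** Integration by parts moves the derivative off the first Hermite factor
    onto [q]; the factor [2 ('X - u)] of the recursion cancels [2 'X] in the
    derivative of the Gaussian and leaves a constant. *)
Lemma gauss_int_hermiteS c (u : R[i]) k (q : {poly R[i]}) :
  gauss_int c (hermite_poly u k.+1 * q) =
  (c - u *+ 2) * gauss_int c (hermite_poly u k * q) + gauss_int c (hermite_poly u k * q^`()).
Proof.
rewrite -[LHS]addr0 -(gauss_int_ibp c (hermite_poly u k * q)) -gauss_intD -gauss_intZ -gauss_intD.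
congr gauss_int; rewrite derivM /= -mul_polyC polyCB polyCMn; ring.
Qed.

(** Both sides obey the same recursion in [k], the derivative of the second
    Hermite factor supplying the term in [m - 1]. For [k = 0] the roles of the
    two factors are exchanged and the derivative of 1 kills the second term,
    which leaves a power of [z]. The scale [s] is the square root of 2 that
    normalises [z] and [w]. *)
Lemma gauss_int_hermite c (u x : R[i]) z w s m k :
  s ^+ 2 = 2 -> c - x *+ 2 = s * z -> c - u *+ 2 = - (s * w) ->
  gauss_int c (hermite_poly u k * hermite_poly x m) =
  gauss_int c 1 * ((-1) ^+ k * s ^+ (k + m) * complex_hermite k m z w).
Proof.
move=> s2 cx cu; elim: k m => [|k IH] m.
  rewrite complex_hermite0l expr0 mul1r add0n mul1r.
  elim: m => [|m IH]; first by rewrite !expr0 !mulr1.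
  rewrite -[X in gauss_int c X]mulr1 gauss_int_hermiteS derivC mulr0 mulr1 IH cx.
  have -> : gauss_int c 0 = 0 by rewrite -[0](scale0r (0 : {poly R[i]})) gauss_intZ mul0r.
  by rewrite !exprS; ring.
rewrite gauss_int_hermiteS deriv_hermite_poly -scalerAr gauss_intZ !IH cu complex_hermiteSl.
case: m => [|m]; first by rewrite double0 !addn0 !exprS; rewrite mulr0n; ring.
rewrite /= !addSn !addnS !exprS -muln2 natrM -s2; ring.
Qed.
End GaussHermite.

(** * The superoscillating sequence *)

Section TrigBounds.
Variable R : realType.
Implicit Types (y t a : R).

Lemma sin_le_norm y : `|sin y| <= `|y|.
Proof.
wlog y0 : y / 0 <= y.
  move=> H; have [/H//|/ltW y0] := leP 0 y.
  by rewrite -normrN -sinN -(normrN y) H// oppr_ge0.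
have [c _] := MVT_segment y0 (fun c _ => is_derive_sin c)
  (continuous_subspaceT (@continuous_sin R)).
rewrite sin0 !subr0 => ->; rewrite normrM ler_piMl//.
exact: cos_max.
Qed.

(** Half-angle formula: [1 - cos y = 2 sin ^ 2 (y / 2)]. *)
Lemma cosB1_le y : `|cos y - 1| <= y ^+ 2 / 2.
Proof.
have -> : cos y - 1 = - (2 * sin (y / 2) ^+ 2).
  rewrite {1}(_ : y = (y / 2) *+ 2); last by field.
  by rewrite cos_mulr2n cos2sin2; ring.
rewrite normrN normrM normrX ger0_norm//.
have := sin_le_norm (y / 2); rewrite -(@ler_pXn2r _ 2)// ?nnegrE// => /(ler_wpM2l (ler0n R 2)).
move/le_trans; apply; rewrite real_normK ?num_real// expr_div_n.
by rewrite le_eqVlt; apply/orP; left; apply/eqP; field.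
Qed.

(** Mean value theorem and the bound on [cos c - 1]; the constant is far from
    optimal, only the order 3 is used. *)
Lemma sinB_le y : `|sin y - y| <= `|y| ^+ 3.
Proof.
wlog y0 : y / 0 <= y.
  move=> H; have [/H//|/ltW y0] := leP 0 y.
  by have := H (- y); rewrite oppr_ge0 => /(_ y0); rewrite sinN -opprD !normrN.
have df (x : R) : is_derive x 1 (@sin R - id) (cos x - 1) by exact: is_deriveB.
have cf : continuous (@sin R - id).
  by move=> x; apply/differentiable_continuous/derivable1_diffP; have [] := df x.
have [c] := MVT_segment y0 (fun c _ => df c) (continuous_subspaceT cf).
rewrite in_itv/= => /andP[c0 cy].
rewrite -[(sin - id) y]/(sin y - y) -[(sin - id) 0]/(sin 0 - 0) sin0 !subr0 => ->.
rewrite normrM exprSr ler_wpM2r// (le_trans (cosB1_le c))// (ger0_norm y0).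
have : c ^+ 2 <= y ^+ 2 by rewrite ler_pXn2r// nnegrE.
have := sqr_ge0 c; lra.
Qed.
End TrigBounds.

Section Superoscillation.
Variable R : realType.
Implicit Types (a t s M : R) (z w : R[i]).

(** The factor whose [n]-th power, at [s = t / n], is the superoscillating
    function: the average of [exp (i s)] and [exp (- i s)] with the weights
    [(1 + a) / 2] and [(1 - a) / 2]. *)
Definition superosc_base a s : R[i] := cos s +i* (a * sin s).

Lemma expC_i s : expC ('i * s%:C) = cos s +i* sin s.
Proof.
have -> : 'i * s%:C = 0 +i* s by apply: complex_ext; rewrite ?(cReM, cImM) /=; ring.
by apply: complex_ext; rewrite ?(Re_expC, Im_expC) /= expR0 mul1r.
Qed.

(** Binomial theorem: the frequency [1 - 2 j / n] is the sum of [n - j] copies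
    of [1 / n] and [j] copies of [- 1 / n]. *)
Lemma superoscE n t a : superosc n.+1 t a = superosc_base a (t / n.+1%:R) ^+ n.+1.
Proof.
set s := t / _.
have -> : superosc_base a s = ((1 + a) / 2)%:C * expC ('i * s%:C) +
    ((1 - a) / 2)%:C * expC ('i * (- s)%:C).
  rewrite !expC_i cosN sinN.
  by apply: complex_ext; rewrite ?(cReD, cImD) !(cReM, cImM) /=; field.
rewrite exprDn /superosc big_mkord; apply: eq_bigr => j _.
rewrite -[RHS]mulr_natr !(exprMn _ _%:C (expC _)) -!expC_mulrn.
have -> : (superosc_coef j n.+1 a)%:C = 'C(n.+1, j)%:R * ((1 + a) / 2)%:C ^+ (n.+1 - j) *
    ((1 - a) / 2)%:C ^+ j.
  by rewrite /superosc_coef -!rmorphXn -(rmorph_nat (real_complex R)) -!rmorphM.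
have -> : expC ('i * ((1 - 2 * j%:R / n.+1%:R) * t)%:C) =
    expC (('i * s%:C) *+ (n.+1 - j)) * expC (('i * (- s)%:C) *+ j).

  rewrite -expCD; congr expC.
  rewrite -!mulrnAr -mulrDr -!rmorphMn -rmorphD; congr ('i * _%:C).
  rewrite mulNrn -[in RHS]mulr_natl -[in RHS]mulr_natl natrB ?leq_ord// /s.
  by field; rewrite nat1r pnatr_eq0.
by rewrite [RHS]mulrC [X in _ = _ * X]mulrACA !mulrA.
Qed.

Lemma normc_superosc_base a s : 0 <= a -> normc (superosc_base a s) <= expR (a * `|s|).
Proof.
move=> a0.
apply: le_trans (expR_ge1Dx _); apply: le_trans (normc_le_ReIm _) _ => /=.
rewrite lerD ?cos_max// normrM ger0_norm// ler_wpM2l//; exact: sin_le_norm.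
Qed.

Lemma expR_divn_X a t n :
  expR (a * `|t / n.+1%:R|) ^+ n.+1 = expR (a * `|t|).
Proof.
rewrite -expRM_natl; congr expR; rewrite normrM normfV normr_nat.
by field; rewrite nat1r pnatr_eq0.
Qed.

(** This bound, uniform in [n], is what makes dominated convergence apply. It
    survives the [n]-th power because it is an exponential. *)
Lemma normc_superosc a n t : 0 <= a -> normc (superosc n.+1 t a) <= expR (a * `|t|).
Proof.
move=> a0; rewrite superoscE normcX -(expR_divn_X a t n).
by rewrite lerXn2r// ?nnegrE ?normc_ge0 ?expR_ge0// normc_superosc_base.
Qed.

Lemma normcXB_le z w M n : 1 <= M -> normc z <= M -> normc w <= M ->
  normc (z ^+ n - w ^+ n) <= n%:R * normc (z - w) * M ^+ n.
Proof.
move=> M1 zM wM; have M0 : 0 <= M by exact: le_trans M1.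
elim: n => [|n IH]; first by rewrite subrr normc0 !mul0r.
have -> : z ^+ n.+1 - w ^+ n.+1 = z * (z ^+ n - w ^+ n) + (z - w) * w ^+ n.
  by rewrite !exprS; ring.
rewrite (le_trans (le_normcD _ _))// !normcM normcX -natr1 mulrDl mul1r mulrDl lerD//.
  by rewrite exprS mulrCA ler_pM// normc_ge0.
rewrite ler_wpM2l ?normc_ge0// (le_trans (lerXn2r _ _ _ wM)) ?nnegrE ?normc_ge0//.
by rewrite exprS ler_peMl// exprn_ge0.
Qed.

(** The two functions of [s] agree to first order at 0, so that the error
    stays [O(1 / n)] after taking the [n]-th power at [s = t / n]. *)
Lemma superosc_base_approx a s : 0 <= a ->
  normc (superosc_base a s - expC ('i * (a * s)%:C)) <=
  (1 + a ^+ 2) / 2 * `|s| ^+ 2 + (a + a ^+ 3) * `|s| ^+ 3.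
Proof.
move=> a0.
rewrite expC_i (le_trans (normc_le_ReIm _))//= lerD//.
  have -> : cos s - cos (a * s) = (cos s - 1) - (cos (a * s) - 1) by ring.
  rewrite (le_trans (ler_normB _ _))// (le_trans (lerD (cosB1_le _) (cosB1_le _)))//.
  by rewrite real_normK ?num_real// le_eqVlt; apply/orP; left; apply/eqP; field.
have -> : a * sin s - sin (a * s) = a * (sin s - s) - (sin (a * s) - a * s) by ring.
rewrite (le_trans (ler_normB _ _))// normrM mulrDl lerD//.
  by rewrite ger0_norm// ler_wpM2l// sinB_le.
by rewrite (le_trans (sinB_le _))// normrM exprMn (ger0_norm a0).
Qed.

(** Superoscillation: each frequency of the sum lies in [[-1, 1]], yet the
    limit has frequency [a]. *)
Lemma cvg_superosc a t : 0 <= a ->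
  normc (superosc n.+1 t a - expC ('i * (a * t)%:C)) @[n --> \oo] --> (0 : R).
Proof.
move=> a0.
pose K := ((1 + a ^+ 2) / 2 * `|t| ^+ 2 + (a + a ^+ 3) * `|t| ^+ 3) * expR (a * `|t|).
apply: (@squeeze_cvgr _ _ _ _ (cst 0) (fun n => K * harmonic n)).
- apply: nearW => n; rewrite normc_ge0/=.
  set s := t / n.+1%:R.
  have -> : expC ('i * (a * t)%:C) = expC ('i * (a * s)%:C) ^+ n.+1.
    rewrite -expC_mulrn; congr expC; rewrite -mulrnAr -rmorphMn -mulr_natr /s.
    by rewrite -mulrA mulfVK// pnatr_eq0.
  rewrite superoscE -/s.
  have M1 : 1 <= expR (a * `|s|) by rewrite -expR0 ler_expR mulr_ge0.
  rewrite (le_trans (normcXB_le _ M1 (normc_superosc_base _ a0) _))//.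
    by rewrite normc_expC cReM /= mul0r mulr0 subr0 expR0.
  rewrite expR_divn_X /K /harmonic [leRHS]mulrAC ler_wpM2r ?expR_ge0//.
  rewrite (le_trans (ler_wpM2l (ler0n _ _) (superosc_base_approx s a0)))//.
  rewrite /s normrM normfV normr_nat.
  set N : R := n.+1%:R; have N0 : N != 0 by rewrite pnatr_eq0.
  have -> : N * ((1 + a ^+ 2) / 2 * (`|t| / N) ^+ 2 + (a + a ^+ 3) * (`|t| / N) ^+ 3) =
      ((1 + a ^+ 2) / 2 * `|t| ^+ 2 + (a + a ^+ 3) * `|t| ^+ 3 / N) / N by field.
  rewrite ler_wpM2r ?invr_ge0 ?ler0n// lerD2l ler_piMr//.
    by rewrite mulr_ge0 ?addr_ge0 ?exprn_ge0.
  by rewrite invf_le1 ?ltr0n// ler1n.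
- exact: cvg_cst.
- by rewrite -(mulr0 K); apply: cvgMl_tmp; exact: cvg_harmonic.
Qed.
End Superoscillation.

(** * Limit of the short-time Fourier transform *)

Section Limit.
Variable R : realType.
Notation mu := (@lebesgue_measure R).
Implicit Types (a t u x eta : R) (c : R[i]) (p : {poly R[i]}).

Lemma measurable_superosc n a :
  measurable_fun setT (fun t => complex.Re (superosc n.+1 t a)) /\
  measurable_fun setT (fun t => complex.Im (superosc n.+1 t a)).
Proof.
have mdiv : measurable_fun setT (fun t : R => t / n.+1%:R) by exact: measurable_funM.
have mcos : measurable_fun setT (fun t : R => cos (t / n.+1%:R)).
  exact: (measurableT_comp (continuous_measurable_fun (@continuous_cos R)) mdiv).
have msin : measurable_fun setT (fun t : R => a * sin (t / n.+1%:R)).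
  apply: measurable_funM => //.
  exact: (measurableT_comp (continuous_measurable_fun (@continuous_sin R)) mdiv).
suff mX k : measurable_fun setT (fun t => complex.Re (superosc_base a (t / n.+1%:R) ^+ k)) /\
    measurable_fun setT (fun t => complex.Im (superosc_base a (t / n.+1%:R) ^+ k)).
  have [mr mi] := mX n.+1.
  by split; under eq_fun do rewrite superoscE.
elim: k => [|k [mr mi]]; first by split; exact: measurable_cst.
split.
  under eq_fun do rewrite exprS cReM.
  exact: measurable_funB (measurable_funM mcos mr) (measurable_funM msin mi).
under eq_fun do rewrite exprS cImM.
exact: measurable_funD (measurable_funM mcos mi) (measurable_funM msin mr).
Qed.

Lemma gauss_poly_modulate c p a t :
  gauss_poly c p t * expC ('i * (a * t)%:C) = gauss_poly (c + 'i * a%:C) p t.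
Proof.
rewrite /gauss_poly -[LHS]mulrA -expCD; congr (_ * expC _).
by rewrite rmorphM; ring.
Qed.

(** Dominated convergence: in the limit the superoscillating factor is a
    modulation, which shifts the parameter of the Gaussian by [i a]. *)
Lemma cvg_gauss_poly_superosc c p a : 0 <= a ->
  (integralC (fun t => gauss_poly c p t * superosc n t a) : R[i]^o) @[n --> \oo] -->
  (gauss_int (c + 'i * a%:C) p : R[i]^o).
Proof.
move=> a0.
(* The product formula for the superoscillating function holds from index 1. *)
rewrite -(@cvg_shiftS (R[i]^o : topologicalType)
  (fun n => integralC (fun t => gauss_poly c p t * superosc n t a))).
have [C hC] := gauss_poly_bound c p a 1.
have dom n t : normc (gauss_poly c p t * superosc n.+1 t a) <= C * half_gauss t.
  have := hC 1 t; rewrite normr1 lexx mul1r => /(_ isT); apply: le_trans.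
  by rewrite normcM ler_wpM2l ?normc_ge0// normc_superosc.
have cv t : complex.Re (gauss_poly c p t * superosc n.+1 t a) @[n --> \oo] -->
      complex.Re (gauss_poly (c + 'i * a%:C) p t) /\
    complex.Im (gauss_poly c p t * superosc n.+1 t a) @[n --> \oo] -->
      complex.Im (gauss_poly (c + 'i * a%:C) p t).
  apply: cvg_ReIm; rewrite -gauss_poly_modulate.
  under eq_fun do rewrite -mulrBr normcM.
  by rewrite -(mulr0 (normc (gauss_poly c p t))); apply: cvgMl_tmp; exact: cvg_superosc.
have [gr gi] := continuous_gauss_poly c p.
have {}gr := continuous_measurable_fun gr; have {}gi := continuous_measurable_fun gi.
apply: cvgC => /=.
  apply: (@Rintegral_half_gauss_cvg _
    (fun n t => complex.Re (gauss_poly c p t * superosc n.+1 t a)) _ C).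
  - move=> n; have [sr si] := measurable_superosc n a.
    by under eq_fun do rewrite cReM; apply: measurable_funB; exact: measurable_funM.
  - by move=> t; have [] := cv t.
  - by move=> n t; rewrite (le_trans (Re_le_normc _)).
apply: (@Rintegral_half_gauss_cvg _
  (fun n t => complex.Im (gauss_poly c p t * superosc n.+1 t a)) _ C).
- move=> n; have [sr si] := measurable_superosc n a.
  by under eq_fun do rewrite cImM; apply: measurable_funD; exact: measurable_funM.
- by move=> t; have [] := cv t.
- by move=> n t; rewrite (le_trans (Im_le_normc _)).
Qed.

(** The two Gaussians centred at [u] and [x] and the phase of the transform
    multiply to a single exponential of a quadratic polynomial in [t], whose
    leading coefficient is [- 1]. *)
Lemma stft_hermiteE (k m : nat) x u eta (F : R -> R[i]) :
  stft (fun t => (hermite_fun k t)%:C) (fun t => (hermite_fun m (t - x))%:C * F t) u eta =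
  integralC (fun t => gauss_poly ((u + x)%:C - 'i * eta%:C)
    ((expR (- ((u ^+ 2 + x ^+ 2) / 2)))%:C *:
      (hermite_poly u%:C k * hermite_poly x%:C m)) t * F t).
Proof.
rewrite /stft; congr integralC; apply/funext => t.
rewrite mulrA -[Num.conj _]/(conjc _) conjc_real; congr (_ * _).
rewrite /gauss_poly hornerZ hornerM !hermite_poly_shift !hermite_funE.
rewrite -expC_real.
set z1 := - _; set z2 := (- _)%:C; set z3 := _ - (t ^+ 2)%:C.
have : expC z1 * (expR (- ((t - u) ^+ 2 / 2)))%:C * (expR (- ((t - x) ^+ 2 / 2)))%:C =
    expC z2 * expC z3.
  rewrite -!expC_real -!expCD /z1 /z2 /z3; congr expC.
  by field.
move=> h; rewrite [RHS]mulrAC -h.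
rewrite ![(_.[_] * expR _)%:C]rmorphM /=.
by rewrite -[LHS]mulrA [X in _ * X = _]mulrACA [X in _ * X = _]mulrC !mulrA.
Qed.

End Limit.

Unset Implicit Arguments.
Set Strict Implicit.

Theorem theorem5p23 (R : realType) (a x u eta : R) (m k : nat) (ha : 1 < a) :
  let alpha : R[i] := ((u - x) +i* (a - eta)) / (Num.sqrt 2)%:C in
  (stft (fun t => (hermite_fun k t)%:C)
        (fun t => superosc_signal m n x a t) u eta : R[i]^o) @[n --> \oo] -->
  ((Num.sqrt pi * (-1) ^+ k * 2 `^ ((k + m)%N%:R / 2))%:C
   * expC (- ((a - eta) ^+ 2 / 4)%:C + 'i * ((x + u) * (a - eta) / 2)%:C
           - ((x - u) ^+ 2 / 4)%:C)
   * complex_hermite k m alpha (alpha^*) : R[i]^o).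
Proof.
move=> alpha; rewrite /superosc_signal.
pose c := (u + x)%:C - 'i * eta%:C.
pose K := expR (- ((u ^+ 2 + x ^+ 2) / 2)).
pose p := K%:C *: (hermite_poly u%:C k * hermite_poly x%:C m).
under eq_fun do rewrite stft_hermiteE -/K -/p -/c.
suff <- : gauss_int (c + 'i * a%:C) p = (Num.sqrt pi * (-1) ^+ k * 2 `^ ((k + m)%N%:R / 2))%:C
   * expC (- ((a - eta) ^+ 2 / 4)%:C + 'i * ((x + u) * (a - eta) / 2)%:C
           - ((x - u) ^+ 2 / 4)%:C)
   * complex_hermite k m alpha (alpha^*) 
  by apply: cvg_gauss_poly_superosc; rewrite ltW// (lt_trans ltr01).
have s2 : (Num.sqrt (2 : R))%:C ^+ 2 = 2 by rewrite -rmorphXn /= sqr_sqrtr// rmorph_nat.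
have s0 : (Num.sqrt (2 : R))%:C != 0.
  by rewrite fmorph_eq0 gt_eqF// sqrtr_gt0.
have cE : c + 'i * a%:C = (u + x) +i* (a - eta).
  rewrite /c -!complexiE.
  by apply: complex_ext; rewrite !(cReD, cImD, cReN, cImN, cReM, cImM) /=; ring.
have alphaE : (Num.sqrt 2)%:C * alpha = (u - x) +i* (a - eta) by rewrite /alpha mulrC divfK.
have alphaJE : (Num.sqrt 2)%:C * alpha^* = (u - x) -i* (a - eta).
  by rewrite -(conjc_real (Num.sqrt 2)) -[RHS]/(((u - x) +i* (a - eta))^*)%C -alphaE -rmorphM.
rewrite /p gauss_intZ (@gauss_int_hermite _ _ _ _ alpha (alpha^*) (Num.sqrt 2)%:C)//; last 2 first.
- rewrite alphaE cE; apply: complex_ext.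
    by rewrite !(cReD, cReN, cImN, mulr2n) /=; ring.
  by rewrite !(cImD, cReN, cImN, mulr2n) /=; ring.
- rewrite alphaJE cE; apply: complex_ext.
    by rewrite !(cReD, cReN, cImN, mulr2n) /=; ring.
  by rewrite !(cImD, cReN, cImN, mulr2n) /=; ring.
have powE : 2 `^ ((k + m)%N%:R / 2) = Num.sqrt 2 ^+ (k + m) :> R.
  by rewrite mulrC powRrM powR12_sqrt// powR_mulrn// sqrtr_ge0.
have gaussE : K%:C * expC ((c + 'i * a%:C) ^+ 2 / 4) =
    expC (- ((a - eta) ^+ 2 / 4)%:C + 'i * ((x + u) * (a - eta) / 2)%:C
           - ((x - u) ^+ 2 / 4)%:C).
  have i2 : 'i ^+ 2 = -1 :> R[i] by exact: sqrCi.
  rewrite -expC_real -expCD; congr expC.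
  have -> : (c + 'i * a%:C) ^+ 2 = (u + x)%:C ^+ 2 + 'i ^+ 2 * (a - eta)%:C ^+ 2
     + 2 * 'i * (u + x)%:C * (a - eta)%:C by rewrite /c; ring.
  by rewrite i2; field.
rewrite gauss_int1 -gaussE powE.
move: (expC ((c + 'i * a%:C) ^+ 2 / 4)) (complex_hermite k m alpha alpha^*) => g h.
by rewrite !rmorphM /= !rmorphXn rmorphN rmorph1; ring.
Qed.
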